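(* Let $a\in\mathbb{Z}_+^n$ and let $\beta$ be a positive integer with $0<a_i\le\beta$ for all $i\in[n]$ and $\sum_{i=1}^n a_i>\beta$, and let $\sigma$ be the number of distinct entries of $a$. Let $\hat{x} \in [0,1]^n$, let $C$ be a minimal cover of the knapsack $\{x\in\{0,1\}^n : a^\top x\le\beta\}$ and let $S$ be a maximal independent set with respect to $C$. Let $\bar{P}$ and $P$ be the polytopes defined in the context. Then $\hat{x} \in \bar{P}$ if and only if there exists a point $(x^0,\dots,x^K) \in P$ such that $$\sum_{j=1}^{\sigma} \sum_{i=1}^{|W_j|} \nu_j(i)\, x^K_{j_i} \le |C| - 1 .$$
   Context: Notation: $[n]=\{1,\dots,n\}$. Covers and lifting data. $C\subseteq[n]$ is a cover if $\sum_{i\in C}a_i>\beta$, and minimal if no proper subset is a cover. For a minimal cover $C$ let $\mu(h)$, $h\in\mathbb{Z}_{\ge 0}$, be the sum of the $\min\{h,|C|\}$ largest weights $a_i$, $i\in C$ (so $\mu(0)=0$), let $\pi_i=\max\{h\in\mathbb{Z}_{\ge0}: a_i\ge\mu(h)\}$ for $i\in[n]$, and let $\Delta(C)=\sum_{i\in C}a_i-\beta$. A set $S\subseteq[n]\setminus C$ is independent with respect to $C$ if every $Q\subseteq S$ satisfies $\sum_{i\in Q}a_i>\mu(\sum_{i\in Q}(\pi_i+1))-\Delta(C)$; it is maximal if it is not properly contained in another independent set. Weight classes. Let $w_1<\dots<w_\sigma$ be the distinct values among $a_1,\dots,a_n$ and $W_j=\{i\in[n]: a_i=w_j\}=\{j_1,\dots,j_{|W_j|}\}$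 (a fixed enumeration). As $\pi_i$ depends only on $a_i$, write $\pi_j$ (for $j\in[\sigma]$) for the common value of $\pi_i$, $i\in W_j$. For $A,A'\subseteq[n]$ write $A\sim A'$ if $|A\cap W_j|=|A'\cap W_j|$ for all $j\in[\sigma]$. Let $\mathcal{M}(C,S)$ be the set of all pairs $(C',S')$ of subsets of $[n]$ with $C'\cap S'=\emptyset$, $C'\sim C$, $S'\sim S$. The polytope $\bar P$ (all equivalent lifted cover inequalities): $$\bar P=\bigcap_{(C',S')\in\mathcal{M}(C,S)}\Bigl\{x\in[0,1]^n:\sum_{i\in S'}(\pi_i+1)x_i+\sum_{i\notin C'\cup S'}\pi_ix_i+\sum_{i\in C'}x_i\le|C|-1\Bigr\}.$$ Coefficients $\nu_j(i)$, for $j\in[\sigma]$, $i\in\{1,\dots,|W_j|\}$. If $\pi_j\ge1$: $\nu_j(i)=1$ for $1\le i\le|W_j\cap C|$; $\nu_j(i)=\pi_j$ for $|W_j\cap C|+1\le i\le|W_j|-|W_j\cap S|$; $\nu_j(i)=\pi_j+1$ for $|W_j|-|W_j\cap S|+1\le i\le|W_j|$. If $\pi_j=0$: $\nu_j(i)=0$ for $1\le i\le|W_j|-|W_j\cap(C\cup S)|$ and $\nu_j(i)=1$ for larger $i\le |W_j|$. Sorting networks. A comparison network on $m$ wires with $K$ steps is a sequence of steps $k=1,\dots,K$, each of which is either a comparator $(i_k,j_k)$ with $1\le i_k<j_k\le m$ or trivial (no comparison). Given an input vector in $\mathbb{R}^m$ assigned to wires $1,\dots,m$, a comparator $(i_k,j_k)$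 puts the smaller of the two current values on wires $i_k,j_k$ on wire $i_k$ and the larger one on wire $j_k$; all other wires are unchanged. The network is a sorting network if for every input the final values on wires $1,\dots,m$ are in non-decreasing order. The polytope $P$. For each $j\in[\sigma]$ fix a sorting network $G_j$ on $|W_j|$ wires, where wire $i$ corresponds to the variable index $j_i\in W_j$; all $G_j$ have the same number $K$ of steps (trivial steps are used for padding). For $j\in[\sigma]$, $P_j(G_j,\hat x)$ is defined by the following constraints on the coordinates in $W_j$ of $x^0,\dots,x^K\in[0,1]^n$: $x^0_l=\hat x_l$ for all $l\in W_j$; and for every step $k\in[K]$, if step $k$ of $G_j$ compares the wires corresponding to the indices $p$ (upper wire, with smaller wire number) and $q$ (lower wire), then $x^k_p\le x^{k-1}_p$, $x^k_p\le x^{k-1}_q$, $x^k_q\ge x^{k-1}_p$, $x^k_q\ge x^{k-1}_q$, $x^k_p+x^k_q=x^{k-1}_p+x^{k-1}_q$, and $x^k_l=x^{k-1}_l$ for all $l\in W_j\setminus\{p,q\}$; if step $k$ is trivial, $x^k_l=x^{k-1}_l$ for all $l\in W_j$. Finally, $P$ is the set of all $(x^0,\dots,x^K)\in([0,1]^n)^{K+1}$ satisfying the constraints of $P_j(G_j,\hat x)$ for all $j\in[\sigma]$. *)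

(* Defs.v *)
From HB Require Import structures.
From mathcomp Require Import all_boot all_order all_algebra.

Set Implicit Arguments.
Unset Strict Implicit.
Unset Printing Implicit Defensive.

Import Order.TTheory GRing.Theory Num.Theory.
Local Open Scope ring_scope.

Definition is_cover (n : nat) (a : 'I_n -> nat) (beta : nat)
    (C : {set 'I_n}) : bool :=
  (beta < \sum_(i in C) a i)%N.

Definition minimal_cover (n : nat) (a : 'I_n -> nat) (beta : nat)
    (C : {set 'I_n}) : bool :=
  minset (is_cover a beta) C.

(* [take] truncates at the end of the list, so this sums the min(h, |C|)
   largest weights of C. *)
Definition mu (n : nat) (a : 'I_n -> nat) (C : {set 'I_n}) (h : nat) : nat :=
  sumn (take h (sort geq [seq a i | i <- enum C])).

(* max {h : mu(h) <= w}. The search can stop at h = |C|: beyond it mu is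
   constantly the weight of C, which exceeds beta when C is a cover; see
   [lift_coefP]. *)
Definition lift_coef (n : nat) (a : 'I_n -> nat) (C : {set 'I_n})
    (w : nat) : nat :=
  (\max_(h < #|C|.+1 | mu a C h <= w) h)%N.

Lemma lift_coefP (n : nat) (a : 'I_n -> nat) (beta : nat) (C : {set 'I_n})
    (w : nat) :
  is_cover a beta C -> (w <= beta)%N ->
  (mu a C (lift_coef a C w) <= w)%N /\
  (forall h : nat, (mu a C h <= w)%N -> (h <= lift_coef a C w)%N).
Proof.
move=> Ccov w_le; split=> [|h mu_le].
  have mu0 : (mu a C (ord0 : 'I_#|C|.+1) <= w)%N by rewrite /mu take0.
  have [|h mu_le eq_h] := @eq_bigmax_cond _
    [pred h : 'I_#|C|.+1 | (mu a C h <= w)%N] (fun h => nat_of_ord h).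
    by apply/card_gt0P; exists ord0; rewrite inE.
  by rewrite /lift_coef eq_h.
have [h_lt|h_gt] := ltnP h #|C|.+1.
  exact: (@leq_bigmax_cond _ (fun h : 'I_#|C|.+1 => (mu a C h <= w)%N)
            (fun h => nat_of_ord h) (Ordinal h_lt)).
have mu_h : mu a C h = (\sum_(i in C) a i)%N.
  rewrite /mu take_oversize; last by rewrite size_sort size_map -cardE ltnW.
  rewrite (perm_sumn (permEl (perm_sort _ _))).
  by rewrite sumnE big_map big_enum.
by move: Ccov; rewrite /is_cover -mu_h ltnNge (leq_trans mu_le w_le).
Qed.

Definition pi_ (n : nat) (a : 'I_n -> nat) (C : {set 'I_n}) (i : 'I_n) : nat :=
  lift_coef a C (a i).

(* Integer-valued: the bound mu(...) - Delta below may be negative. *)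
Definition Delta (n : nat) (a : 'I_n -> nat) (beta : nat)
    (C : {set 'I_n}) : int :=
  (\sum_(i in C) a i)%N%:Z - beta%:Z.

Definition independent (n : nat) (a : 'I_n -> nat) (beta : nat)
    (C S : {set 'I_n}) : bool :=
  (S \subset ~: C) &&
  [forall Q : {set 'I_n}, (Q \subset S) ==>
     ((\sum_(i in Q) a i)%N%:Z
        > (mu a C (\sum_(i in Q) (pi_ a C i).+1)%N)%:Z - Delta a beta C)].

Definition maximal_independent (n : nat) (a : 'I_n -> nat) (beta : nat)
    (C S : {set 'I_n}) : bool :=
  maxset (independent a beta C) S.

Definition weights (n : nat) (a : 'I_n -> nat) : seq nat :=
  sort leq (undup [seq a i | i : 'I_n]).

Definition sigma (n : nat) (a : 'I_n -> nat) : nat := size (weights a).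

Definition weight (n : nat) (a : 'I_n -> nat) (j : 'I_(sigma a)) : nat :=
  nth 0%N (weights a) j.

Definition W (n : nat) (a : 'I_n -> nat) (j : 'I_(sigma a)) : {set 'I_n} :=
  [set i | a i == weight j].

Definition enumerates (n : nat) (A : {set 'I_n}) (e : 'I_#|A| -> 'I_n) : Prop :=
  injective e /\ codom e =i A.

Definition class_pi (n : nat) (a : 'I_n -> nat) (C : {set 'I_n})
    (j : 'I_(sigma a)) : nat :=
  lift_coef a C (weight j).

Lemma class_piE (n : nat) (a : 'I_n -> nat) (C : {set 'I_n})
    (j : 'I_(sigma a)) (i : 'I_n) :
  i \in W j -> pi_ a C i = class_pi C j.
Proof. by rewrite inE /pi_ /class_pi => /eqP->. Qed.

Definition equivalent (n : nat) (a : 'I_n -> nat) (A A' : {set 'I_n}) : bool :=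
  [forall j : 'I_(sigma a), #|A :&: W j| == #|A' :&: W j|].

Definition equivalent_pairs (n : nat) (a : 'I_n -> nat) (C S : {set 'I_n}) :
    {set {set 'I_n} * {set 'I_n}} :=
  [set CS | [&& CS.1 :&: CS.2 == set0, equivalent a CS.1 C
              & equivalent a CS.2 S]].

Definition in_unit_cube (R : realFieldType) (n : nat) (x : 'rV[R]_n) : Prop :=
  forall i : 'I_n, 0 <= x 0 i <= 1.

Definition in_Pbar (R : realFieldType) (n : nat) (a : 'I_n -> nat)
    (C S : {set 'I_n}) (x : 'rV[R]_n) : Prop :=
  forall C' S' : {set 'I_n}, (C', S') \in equivalent_pairs a C S ->
    in_unit_cube x /\
    \sum_(i in S') (pi_ a C i + 1)%N%:R * x 0 i
      + \sum_(i | i \notin C' :|: S') (pi_ a C i)%:R * x 0 i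
      + \sum_(i in C') x 0 i <= #|C|%:R - 1.

(* The argument i is the 1-based position in the class. *)
Definition nu (n : nat) (a : 'I_n -> nat) (C S : {set 'I_n})
    (j : 'I_(sigma a)) (i : nat) : nat :=
  (if 1 <= class_pi C j then
     if i <= #|W j :&: C| then 1
     else if i <= #|W j| - #|W j :&: S| then class_pi C j
     else class_pi C j + 1
   else if i <= #|W j| - #|W j :&: (C :|: S)| then 0 else 1)%N.

Definition comparator (m : nat) : Type :=
  {c : 'I_m * 'I_m | (c.1 < c.2)%N}.

Definition upper (m : nat) (c : comparator m) : 'I_m := (val c).1.
Definition lower (m : nat) (c : comparator m) : 'I_m := (val c).2.

(* [None] is a trivial step. *)
Definition network (m K : nat) : Type := K.-tuple (option (comparator m)).

Definition run_step (R : realFieldType) (m : nat) (v : 'rV[R]_m)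
    (s : option (comparator m)) : 'rV[R]_m :=
  if s is Some c then
    \row_l (if l == upper c then Num.min (v 0 (upper c)) (v 0 (lower c))
            else if l == lower c then Num.max (v 0 (upper c)) (v 0 (lower c))
            else v 0 l)
  else v.

Definition run (R : realFieldType) (m K : nat) (G : network m K)
    (v : 'rV[R]_m) : 'rV[R]_m :=
  foldl (@run_step R m) v G.

Definition sorting_network (R : realFieldType) (m K : nat)
    (G : network m K) : Prop :=
  forall (v : 'rV[R]_m) (i j : 'I_m), (i <= j)%N -> run G v 0 i <= run G v 0 j.

(* One step of the network on the indices in A, from y to z; wire i of the
   network carries the coordinate e i. *)
Definition step_constraints (R : realFieldType) (n m : nat) (A : {set 'I_n})
    (e : 'I_m -> 'I_n) (s : option (comparator m)) (y z : 'rV[R]_n) : Prop :=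
  if s is Some c then
    let p := e (upper c) in
    let q := e (lower c) in
    [/\ z 0 p <= y 0 p /\ z 0 p <= y 0 q,
        z 0 q >= y 0 p /\ z 0 q >= y 0 q,
        z 0 p + z 0 q = y 0 p + y 0 q
      & forall l : 'I_n, l \in A :\: [set p; q] -> z 0 l = y 0 l]
  else forall l : 'I_n, l \in A -> z 0 l = y 0 l.

(* For k : 'I_K, standing for step k + 1, [widen_ord (leqnSn K) k] and
   [lift ord0 k] are the indices k and k + 1 in 'I_K.+1. *)
Definition in_Pj (R : realFieldType) (n : nat) (a : 'I_n -> nat) (K : nat)
    (j : 'I_(sigma a)) (e : 'I_#|W j| -> 'I_n) (G : network #|W j| K)
    (xhat : 'rV[R]_n) (x : 'I_K.+1 -> 'rV[R]_n) : Prop :=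
  (forall l : 'I_n, l \in W j -> x ord0 0 l = xhat 0 l) /\
  (forall k : 'I_K,
     step_constraints (W j) e (tnth G k)
       (x (widen_ord (leqnSn K) k)) (x (lift ord0 k))).

Definition in_P (R : realFieldType) (n : nat) (a : 'I_n -> nat) (K : nat)
    (e : forall j : 'I_(sigma a), 'I_#|W j| -> 'I_n)
    (G : forall j : 'I_(sigma a), network #|W j| K)
    (xhat : 'rV[R]_n) (x : 'I_K.+1 -> 'rV[R]_n) : Prop :=
  (forall k : 'I_K.+1, in_unit_cube (x k)) /\
  (forall j : 'I_(sigma a), in_Pj (e j) (G j) xhat x).

(* Main.v *)
Require Import Defs.
From HB Require Import structures.
From mathcomp Require Import all_boot all_order all_algebra.
From mathcomp Require Import all_fingroup zify ring.

Set Implicit Arguments.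
Unset Strict Implicit.
Unset Printing Implicit Defensive.

Import Order.TTheory GRing.Theory Num.Theory.
Local Open Scope ring_scope.

(* The inequalities of Pbar differ only in how the multiset of coefficients
   {nu_j(1), ..., nu_j(|W_j|)} is distributed over each weight class W_j.

   If xhat lies in Pbar, let x^k be the actual run of the networks on xhat:
   then x^K is xhat permuted within the classes by some s_j, and the sorted
   inequality for x^K is the inequality of the pair (C', S') obtained by moving
   the positions of C and S through the s_j.

   Conversely, given a point of P, run the networks on the coefficients c of a
   pair (C', S'). At each step <c^(k-1), x^(k-1)> <= <c^k, x^k>, although x^k
   need not be sorted, and c^K is sorted, hence equal to nu; so
   <c, xhat> <= <nu, x^K>. *)

(** * Rearrangement inequality, and matching of finite families by their values *)

(** Eliminating [z2] turns the difference of the two sides into [(d - c) * (y1 - z1)] or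
    [(c - d) * (y2 - z1)], a product of nonnegative factors. *)
Lemma min_max_mulr_ge (R : realFieldType) (c d y1 y2 z1 z2 : R) :
  z1 <= y1 -> z1 <= y2 -> z1 + z2 = y1 + y2 ->
  c * y1 + d * y2 <= Num.min c d * z1 + Num.max c d * z2.
Proof.
move=> le1 le2 /(canRL (addKr _)) ->; rewrite -subr_ge0.
case: (leP c d) => [le_cd | /ltW le_dc].
  have -> : c * z1 + d * (- z1 + (y1 + y2)) - (c * y1 + d * y2)
          = (d - c) * (y1 - z1).
    by ring.
  by rewrite mulr_ge0 ?subr_ge0.
have -> : d * z1 + c * (- z1 + (y1 + y2)) - (c * y1 + d * y2)
        = (c - d) * (y2 - z1).
  by ring.
by rewrite mulr_ge0 ?subr_ge0.
Qed.

Lemma card_ord_itv (m lo hi : nat) :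
  (hi <= m)%N -> #|[set i : 'I_m | (lo <= i < hi)%N]| = (hi - lo)%N.
Proof.
move=> le_hi; rewrite cardsE -sum1_card big_mkcond /=.
(* The form with [minn hi m] holds for every [m], which makes induction on [m] possible. *)
suff -> : (\sum_(i < m) (if (lo <= i < hi)%N then 1 else 0) =
           minn hi m - lo)%N by rewrite (minn_idPl le_hi).
elim: m {le_hi} => [|m IHm]; first by rewrite big_ord0 minn0.
rewrite big_ord_recr /= IHm; case: ifP; lia.
Qed.

(** Letting [a] range over all predicates compares the multiplicities of values, so the two value
    tuples are permutations of each other. *)
Lemma eq_count_ord_perm (T : eqType) (m : nat) (f g : 'I_m -> T) :
  (forall a : pred T, \sum_(i < m) a (f i) = \sum_(i < m) a (g i))%N ->
  exists s : 'S_m, forall i, f i = g (s i).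
Proof.
move=> eq_fg.
have /tuple_permP[s eq_s] : perm_eq [tuple f i | i < m] [tuple g i | i < m].
  apply/seq.permP => a.
  suff cnt (h : 'I_m -> T) :
      count a [tuple h i | i < m] = (\sum_(i < m) a (h i))%N.
    by rewrite !cnt.
  rewrite -sum1_count big_map big_mkcond /= big_enum /=.
  by apply: eq_bigr => i _; case: (a _).
exists s => i; have := congr1 (fun t => nth (f i) t i) eq_s.
by rewrite -!tnth_nth !tnth_mktuple.
Qed.

Lemma sum_nat_coloring (T : Type) (m : nat) (A B : {set 'I_m}) (u v w : T)
    (a : pred T) :
  [disjoint A & B] ->
  (\sum_(i < m) a (if i \in B then u else if i \in A then v else w) =
   #|B| * a u + (#|A| * a v + (m - #|A| - #|B|) * a w))%N.
Proof.
move=> dAB; rewrite (bigID (mem B)) /=.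
rewrite (eq_bigr (fun=> nat_of_bool (a u))) => [|i ->//].
rewrite sum_nat_const; congr (_ + _)%N.
rewrite (bigID (mem A)) /=.
rewrite (eq_bigr (fun=> nat_of_bool (a v))); last first.
  by move=> i /andP[/negPf-> ->].
rewrite [X in (_ + X)%N](eq_bigr (fun=> nat_of_bool (a w))); last first.
  by move=> i /andP[/negPf-> /negPf->].
rewrite !sum_nat_const; congr (_ * _ + _ * _)%N.
  apply: eq_card => i; rewrite unfold_in andb_idl // => Ai.
  by rewrite (disjointFr dAB).
have <- : #|~: (A :|: B)| = (m - #|A| - #|B|)%N.
  rewrite cardsCs setCK card_ord cardsU disjoint_setI0 //.
  by rewrite cards0 subn0 subnDA.
by apply: eq_card => i; rewrite !inE negb_or unfold_in andbC.
Qed.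

(** The multiset of values of a colouring depends only on the sizes of its colour sets. The three
    values may coincide, so [s] matches values and need not map [B] to [B']. *)
Lemma coloring_perm (T : eqType) (m : nat) (A B A' B' : {set 'I_m})
    (u v w : T) :
  [disjoint A & B] -> [disjoint A' & B'] -> #|A| = #|A'| -> #|B| = #|B'| ->
  exists s : 'S_m, forall i,
    (if i \in B then u else if i \in A then v else w) =
    (if s i \in B' then u else if s i \in A' then v else w).
Proof.
move=> dAB dAB' eqA eqB.
pose color (D E : {set 'I_m}) i :=
  if i \in E then u else if i \in D then v else w.
apply: (@eq_count_ord_perm _ _ (color A B) (color A' B')) => a.
by rewrite !sum_nat_coloring // eqA eqB.
Qed.

(** Both families are the sorted form of one multiset. This identifies the output of a sorting
    network with [nu]. *)
Lemma nondecreasing_perm_eq (R : realFieldType) (m : nat) (u v : 'I_m -> R)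
    (s : 'S_m) :
  {homo u : i j / (i <= j)%N >-> i <= j} ->
  {homo v : i j / (i <= j)%N >-> i <= j} ->
  (forall i, u i = v (s i)) -> u =1 v.
Proof.
move=> u_homo v_homo u_v i.
have srt (w : 'I_m -> R) : {homo w : i j / (i <= j)%N >-> i <= j} ->
    sorted <=%R [tuple w i | i < m].
  move=> w_homo; apply: (homo_sorted w_homo).
  rewrite -[sorted _ _]/(sorted (relpre val leq) _) -sorted_map val_enum_ord.
  exact: iota_sorted.
have eq_uv : [tuple u i | i < m] = [tuple v i | i < m] :> seq R.
  apply: (sorted_eq le_trans le_anti); [exact: srt | exact: srt |].
  apply/tuple_permP; exists s; congr val; apply: eq_mktuple => k.
  by rewrite tnth_mktuple u_v.
have := congr1 (fun t => nth (u i) t i) eq_uv.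
by rewrite -!tnth_nth !tnth_mktuple.
Qed.

(** * Comparison networks and their linear constraints *)

Section Networks.

Variables (R : realFieldType) (m : nat).
Implicit Types (v : 'rV[R]_m) (G : seq (option (comparator m))).

Lemma upper_neq_lower (c : comparator m) : upper c != lower c.
Proof. by rewrite neq_ltn /upper /lower (valP c). Qed.

(** Each comparator acts as the identity or as the transposition of its two wires, depending on the
    values there. *)
Lemma foldl_run_step_perm G v :
  exists s : 'S_m, foldl (@run_step R m) v G = col_perm s v.
Proof.
elim: G v => [|o G IHG] v /=; first by exists 1%g; rewrite col_perm1.
have [s ->] := IHG (run_step v o).
suff [t ->] : exists t : 'S_m, run_step v o = col_perm t v.
  by exists (s * t)%g; rewrite col_permM.
case: o => [c|] /=; last by exists 1%g; rewrite col_perm1.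
case: (leP (v 0 (upper c)) (v 0 (lower c))) => _.
  exists 1%g; rewrite col_perm1; apply/rowP => l; rewrite mxE.
  by case: eqP => [->|_] //; case: eqP => [->|].
exists (tperm (upper c) (lower c)); apply/rowP => l; rewrite !mxE.
by case: tpermP => [->|->|/eqP/negPf-> /eqP/negPf->//]; rewrite ?eqxx // eq_sym
  (negPf (upper_neq_lower c)).
Qed.

Lemma run_stepP n (A : {set 'I_n}) (e : 'I_m -> 'I_n) (y z : 'rV[R]_n)
    (o : option (comparator m)) v :
  injective e -> codom e =i A ->
  (forall i, y 0 (e i) = v 0 i) -> (forall i, z 0 (e i) = run_step v o 0 i) ->
  step_constraints A e o y z.
Proof.
move=> e_inj e_A y_v z_v; case: o z_v => [c|] z_v /=; last first.
  by move=> l; rewrite -e_A => /codomP[i ->]; rewrite z_v y_v.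
have neq_c := upper_neq_lower c.
have zp : z 0 (e (upper c)) = Num.min (v 0 (upper c)) (v 0 (lower c)).
  by rewrite z_v mxE eqxx.
have zq : z 0 (e (lower c)) = Num.max (v 0 (upper c)) (v 0 (lower c)).
  by rewrite z_v mxE eqxx eq_sym (negPf neq_c).
rewrite zp zq !y_v !ge_min !le_max !lexx ?orbT; split=> //.
  by rewrite addr_min_max.
move=> l; rewrite !inE negb_or -e_A => /andP[/andP[l_p l_q] /codomP[i def_l]].
move: l_p l_q; rewrite {l}def_l !(inj_eq e_inj) => /negPf i_p /negPf i_q.
by rewrite z_v y_v mxE i_p i_q.
Qed.

(* Rearrangement: the constraints make the values of y on the compared wires
   convex combinations of those of z, so sorting the coefficients along with
   them cannot decrease the weighted sum. *)
Lemma run_step_sum_le n (A : {set 'I_n}) (e : 'I_m -> 'I_n) (y z : 'rV[R]_n)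
    (o : option (comparator m)) v :
  injective e -> codom e =i A -> step_constraints A e o y z ->
  \sum_i v 0 i * y 0 (e i) <= \sum_i run_step v o 0 i * z 0 (e i).
Proof.
move=> e_inj e_A; have eA i : e i \in A by rewrite -e_A codom_f.
case: o => [c|] /= yz; last first.
  by apply: ler_sum => i _; rewrite yz.
have neq_c := upper_neq_lower c; case: yz => [[zp1 zp2] _ zpq yz].
rewrite [leLHS](bigD1 (upper c)) //= [leRHS](bigD1 (upper c)) //=.
rewrite [X in _ + X <= _](bigD1 (lower c)) 1?eq_sym //=.
rewrite [X in _ <= _ + X](bigD1 (lower c)) 1?eq_sym //=.
rewrite !addrA lerD //.
  rewrite !mxE !eqxx [lower c == _]eq_sym (negPf neq_c).
  exact: min_max_mulr_ge.
apply: ler_sum => i /andP[i_p i_q]; rewrite mxE (negPf i_p) (negPf i_q) yz //.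
by rewrite !inE !(inj_eq e_inj) negb_or i_p i_q eA.
Qed.

Lemma run_sum_le n K (A : {set 'I_n}) (e : 'I_m -> 'I_n) (G : network m K)
    (x : 'I_K.+1 -> 'rV[R]_n) v :
  injective e -> codom e =i A ->
  (forall k : 'I_K, step_constraints A e (tnth G k)
     (x (widen_ord (leqnSn K) k)) (x (lift ord0 k))) ->
  \sum_i v 0 i * x ord0 0 (e i) <= \sum_i run G v 0 i * x ord_max 0 (e i).
Proof.
move=> e_inj e_A x_step.
(* [o] is [k] as an ordinal: the induction runs over the naturals while [x] stays indexed by
   ordinals. *)
suff main k (o : 'I_K.+1) : o = k :> nat -> \sum_i v 0 i * x ord0 0 (e i) <=
    \sum_i foldl (@run_step R m) v (take k G) 0 i * x o 0 (e i).
  by have := main K ord_max erefl; rewrite take_oversize ?size_tuple.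
elim: k o => [|k IHk] o def_o.
  by rewrite take0 /= (_ : o = ord0) //; apply: val_inj.
have lt_kK : (k < K)%N by rewrite -ltnS -def_o.
apply: le_trans (IHk (widen_ord (leqnSn K) (Ordinal lt_kK)) erefl) _.
rewrite (take_nth None) ?size_tuple // foldl_rcons.
have := run_step_sum_le (foldl (@run_step R m) v (take k G)) e_inj e_A
  (x_step (Ordinal lt_kK)).
rewrite (tnth_nth None) /=.
by have -> : lift ord0 (Ordinal lt_kK) = o by apply: val_inj.
Qed.

End Networks.

(** * Partition of the indices into weight classes *)

(** [weights a] is duplicate-free and contains [a l], so the index of [a l] in it is the only class
    of [l]. *)
Lemma mem_W (n : nat) (a : 'I_n -> nat) (l : 'I_n) :
  exists j0 : 'I_(sigma a), forall j, (l \in W j) = (j == j0).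
Proof.
have uniq_w : uniq (weights a) by rewrite sort_uniq undup_uniq.
have lt_l : (index (a l) (weights a) < sigma a)%N.
  by rewrite index_mem mem_sort mem_undup map_f // mem_enum.
exists (Ordinal lt_l) => j; rewrite inE /weight -val_eqE /= eq_sym.
by rewrite -{1}(nth_index 0%N (etrans (esym (index_mem _ _)) lt_l)) nth_uniq.
Qed.

Section Classes.

Variables (n : nat) (a : 'I_n -> nat).
Variable e : forall j : 'I_(sigma a), 'I_#|W j| -> 'I_n.
Hypothesis e_enum : forall j, enumerates (@e j).

Let e_inj j : injective (@e j) := proj1 (e_enum j).
Let codom_e j : codom (@e j) =i W j := proj2 (e_enum j).

Lemma enum_W (l : 'I_n) : exists j i, l = @e j i.
Proof.
have [j0 l_W] := mem_W a l; exists j0.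
by have := l_W j0; rewrite eqxx -codom_e => /codomP[i ->]; exists i.
Qed.

Lemma mem_enum_W j i j' : (@e j i \in W j') = (j' == j).
Proof.
have [j0 l_W] := mem_W a (@e j i).
by rewrite l_W (_ : j = j0) //; apply/eqP; rewrite -l_W -codom_e codom_f.
Qed.

Lemma sum_classes (V : nmodType) (F : 'I_n -> V) :
  \sum_l F l = \sum_j \sum_i F (@e j i).
Proof.
transitivity (\sum_(j < sigma a) \sum_(l in W j) F l).
  rewrite (exchange_big_dep predT) //=; apply: eq_bigr => l _.
  have [j0 l_W] := mem_W a l.
  by rewrite (eq_bigl _ _ l_W) big_pred1_eq.
apply: eq_bigr => j _.
rewrite -(eq_bigl _ _ (@codom_e j)) -big_uniq /=; first by rewrite big_image.
by rewrite map_inj_uniq ?enum_uniq //; exact: e_inj.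
Qed.

Lemma card_setI_class (X : {set 'I_n}) j :
  #|X :&: W j| = #|[set i | @e j i \in X]|.
Proof.
rewrite -(card_imset _ (@e_inj j)).
apply: eq_card => l; rewrite in_setI.
apply/andP/imsetP => [[Xl] | [i]].
  rewrite -[l \in _]codom_e => /codomP[i def_l].
  by exists i; rewrite ?inE -?def_l.
by rewrite inE => Xi ->; split=> //; rewrite -[_ \in _]codom_e codom_f.
Qed.

(** Joins position sets chosen class by class into one index set; [C'] and [S'] are built this
    way. *)
Definition glue (X : forall j : 'I_(sigma a), {set 'I_#|W j|}) : {set 'I_n} :=
  [set l | [exists j, [exists i, (i \in X j) && (@e j i == l)]]].

Lemma mem_glue X j i : (@e j i \in glue X) = (i \in X j).
Proof.
rewrite inE; apply/existsP/idP => [[j' /existsP[i' /andP[Xi' /eqP eq_e]]]|Xi].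
  have /eqP eq_j : j' == j by rewrite -(mem_enum_W i) -eq_e mem_enum_W.
  by subst j'; rewrite -((@e_inj j) _ _ eq_e).
by exists j; apply/existsP; exists i; rewrite Xi eqxx.
Qed.

Lemma in_P_run (R : realFieldType) K
    (G : forall j : 'I_(sigma a), network #|W j| K) (xhat : 'rV[R]_n) :
  in_unit_cube xhat ->
  exists x : 'I_K.+1 -> 'rV[R]_n, in_P e G xhat x /\
    forall j i, x ord_max 0 (@e j i) = run (G j) (\row_i xhat 0 (@e j i)) 0 i.
Proof.
move=> xhat_cube.
pose v j : 'rV[R]_#|W j| := \row_i xhat 0 (@e j i).
pose y (k : nat) j := foldl (@run_step R _) (v j) (take k (G j)).
(* Each [l] is [e j i] for exactly one pair, so the double sum has a single term and serves as an
   inverse of [e]. *)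
pose x (k : 'I_K.+1) : 'rV[R]_n :=
  \row_l \sum_j \sum_(i | @e j i == l) y k j 0 i.
have xE k j i : x k 0 (@e j i) = y k j 0 i.
  rewrite mxE (bigD1 j) //= [X in _ + X]big1 ?addr0 => [|j' neq_j].
    by rewrite (eq_bigl _ _ (fun i' => inj_eq (@e_inj j) i' i)) big_pred1_eq.
  apply: big_pred0 => i'; apply: contraNF neq_j => /eqP eq_e.
  by rewrite -(mem_enum_W i) -eq_e mem_enum_W.
exists x; split; last first.
  by move=> j i; rewrite xE /y take_oversize ?size_tuple.
split=> [k l | j].
  have [j [i ->]] := enum_W l; rewrite xE /y.
  (* The values stay in the unit interval because the run only permutes entries of [xhat]. *)
  have [s ->] := foldl_run_step_perm (take k (G j)) (v j).
  by rewrite !mxE.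
split=> [l | k].
  by rewrite -codom_e => /codomP[i ->]; rewrite xE /y take0 mxE.
apply: (@run_stepP _ _ _ _ _ _ _ _ (y k j)) => // i; rewrite xE //.
by rewrite /y /= (take_nth None) ?size_tuple // foldl_rcons (tnth_nth None).
Qed.

End Classes.

(** * Coefficients of the sorted and of the lifted inequalities *)

Section Coefficients.

Variables (n : nat) (a : 'I_n -> nat) (C S : {set 'I_n}).
Hypothesis disjCS : [disjoint C & S].

(* Positions of the coefficients of C in nu_j: they come first if pi_j >= 1,
   and right before those of S if pi_j = 0, since then pi_j < 1. *)
Definition nuC (j : 'I_(sigma a)) : {set 'I_#|W j|} :=
  let lo := (if 1 <= class_pi C j then 0
             else #|W j| - #|W j :&: C| - #|W j :&: S|)%N in
  [set i : 'I_#|W j| | (lo <= i < lo + #|W j :&: C|)%N].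

Definition nuS (j : 'I_(sigma a)) : {set 'I_#|W j|} :=
  [set i : 'I_#|W j| | (#|W j| - #|W j :&: S| <= i < #|W j|)%N].

Lemma card_classCS (j : 'I_(sigma a)) :
  (#|W j :&: (C :|: S)| = #|W j :&: C| + #|W j :&: S|)%N.
Proof.
by rewrite setIUr cardsU -setIIr (disjoint_setI0 disjCS) setI0 cards0 subn0.
Qed.

Lemma leq_classCS (j : 'I_(sigma a)) :
  (#|W j :&: C| + #|W j :&: S| <= #|W j|)%N.
Proof. by rewrite -card_classCS subset_leq_card ?subsetIl. Qed.

Lemma card_nuC j : #|nuC j| = #|W j :&: C|.
Proof.
have := leq_classCS j; rewrite /nuC; case: ifP => _ le_CS;
  rewrite card_ord_itv; lia.
Qed.

Lemma card_nuS j : #|nuS j| = #|W j :&: S|.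
Proof. by have := leq_classCS j; rewrite card_ord_itv; lia. Qed.

Lemma disjoint_nuCS j : [disjoint nuC j & nuS j].
Proof.
apply/pred0P => i /=; rewrite !inE; have := leq_classCS j.
by case: ifP; lia.
Qed.

(** Positions are 0-based in [nuC] and [nuS] but 1-based in [nu]. If pi_j = 0, both sets carry the
    coefficient 1 and together fill the last positions. *)
Lemma nu_coloring j (i : 'I_#|W j|) :
  nu C S j i.+1 = (if i \in nuS j then class_pi C j + 1
                   else if i \in nuC j then 1 else class_pi C j)%N.
Proof.
have := leq_classCS j; have := ltn_ord i.
rewrite /nu card_classCS !inE; case: (class_pi C j) => [|p] /=;
  do !case: ifP => //; lia.
Qed.

(** The values come in the order 1, pi_j, pi_j + 1 if pi_j >= 1, and 0, 1 otherwise. *)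
Lemma nu_homo (j : 'I_(sigma a)) (i i' : nat) :
  (i <= i')%N -> (nu C S j i <= nu C S j i')%N.
Proof.
move=> le_i; have := leq_classCS j; rewrite /nu card_classCS.
by case: (class_pi C j) => [|p] /=; do !case: ifP => //; lia.
Qed.

Definition lifted_coef (C' S' : {set 'I_n}) (l : 'I_n) : nat :=
  (if l \in S' then pi_ a C l + 1 else if l \in C' then 1 else pi_ a C l)%N.

Lemma lifted_coef_sum (R : realFieldType) (C' S' : {set 'I_n})
    (x : 'I_n -> R) :
  [disjoint C' & S'] ->
  \sum_(i in S') (pi_ a C i + 1)%N%:R * x i
    + \sum_(i | i \notin C' :|: S') (pi_ a C i)%:R * x i
    + \sum_(i in C') x i = \sum_l (lifted_coef C' S' l)%:R * x l.
Proof.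
move=> dCS; rewrite -addrA [RHS](bigID (mem S')) /=; congr (_ + _).
  by apply: eq_bigr => l S'l; rewrite /lifted_coef S'l.
rewrite addrC [RHS](bigID (mem C')) /=; congr (_ + _).
  apply: eq_big => [l|l C'l].
    by rewrite andb_idl // => C'l; rewrite (disjointFr dCS).
  by rewrite /lifted_coef (disjointFr dCS) // C'l mul1r.
apply: eq_big => [l|l]; first by rewrite inE negb_or andbC.
by rewrite inE negb_or /lifted_coef => /andP[/negPf-> /negPf->].
Qed.

End Coefficients.

Theorem theorem12 (R : realFieldType) (n : nat) (a : 'I_n -> nat) (beta : nat)
    (beta_gt0 : (0 < beta)%N)
    (a_bounds : forall i : 'I_n, (0 < a i <= beta)%N)
    (a_sum : (beta < \sum_(i < n) a i)%N)
    (xhat : 'rV[R]_n) (xhat_cube : in_unit_cube xhat)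
    (C : {set 'I_n}) (C_min : minimal_cover a beta C)
    (S : {set 'I_n}) (S_max : maximal_independent a beta C S)
    (e : forall j : 'I_(sigma a), 'I_#|W j| -> 'I_n)
    (e_enum : forall j : 'I_(sigma a), enumerates (e j))
    (K : nat) (G : forall j : 'I_(sigma a), network #|W j| K)
    (G_sort : forall j : 'I_(sigma a), sorting_network R (G j)) :
  in_Pbar a C S xhat <->
  exists x : 'I_K.+1 -> 'rV[R]_n,
    in_P e G xhat x /\
    \sum_(j < sigma a) \sum_(i < #|W j|)
       (nu C S j i.+1)%:R * x ord_max 0 (e j i) <= #|C|%:R - 1.
Proof.
have dCS : [disjoint C & S].
  have /andP[sSC _] := maxsetp S_max.
  by rewrite disjoint_sym disjoints_subset.
split=> [xhatP | [x [[_ xP] le_x]] C' S'].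
  have [x [xP xK]] := in_P_run e_enum G xhat_cube.
  exists x; split=> //.
  have /fin_all_exists[s xs] j : exists s : 'S_#|W j|, forall i,
      x ord_max 0 (e j i) = xhat 0 (e j (s i)).
    have [s run_s] := foldl_run_step_perm (G j) (\row_i xhat 0 (e j i)).
    by exists s => i; rewrite xK /run run_s !mxE.
  (* Each class is enumerated anew so that the final wire [i] carries the value of [xhat] at
     [e' j i]. *)
  pose e' j i := e j (s j i).
  have e'_enum j : enumerates (@e' j).
    have [e_inj e_W] := e_enum j; split=> [|l].
      exact: inj_comp e_inj perm_inj.
    rewrite -e_W; apply/codomP/codomP => -[i ->]; first by exists (s j i).
    by exists ((s j)^-1 i)%g; rewrite /e' permKV.
  have e'C := mem_glue e'_enum (nuC C S); have e'S := mem_glue e'_enum (nuS S).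
  set C' := glue _ _ in e'C; set S' := glue _ _ in e'S.
  have dCS' : [disjoint C' & S'].
    apply/pred0P => l /=; have [j [i ->]] := enum_W e'_enum l.
    by rewrite e'C e'S; have /pred0P/(_ i) := disjoint_nuCS dCS j.
  have /xhatP[_] : (C', S') \in equivalent_pairs a C S.
    rewrite inE /= disjoint_setI0 // eqxx /=; apply/andP; split.
      apply/forallP => j; rewrite (card_setI_class e'_enum).
      rewrite (setIC C) -(card_nuC dCS); apply/eqP/eq_card => i.
      by rewrite inE e'C.
    apply/forallP => j; rewrite (card_setI_class e'_enum).
    rewrite (setIC S) -(card_nuS dCS); apply/eqP/eq_card => i.
    by rewrite inE e'S.
  rewrite (lifted_coef_sum a C _ dCS') (sum_classes e'_enum).
  apply: le_trans; apply: ler_sum => j _; apply: ler_sum => i _.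
  rewrite xs -/(e' j i) nu_coloring // /lifted_coef e'C e'S.
  by rewrite (@class_piE _ _ _ j) ?mem_enum_W.
rewrite inE => /and3P[/= /eqP CS'0 /forallP eqC /forallP eqS].
have dCS' : [disjoint C' & S'] by rewrite -setI_eq0 CS'0.
split=> //; rewrite (lifted_coef_sum a C _ dCS') (sum_classes e_enum).
apply: le_trans le_x; apply: ler_sum => j _.
have [e_inj e_W] := e_enum j; have [x0 x_step] := xP j.
(* The network is now run on the coefficients of the pair instead of on a point. *)
pose c : 'rV[R]_#|W j| := \row_i (lifted_coef a C C' S' (e j i))%:R.
have := run_sum_le c e_inj e_W x_step.
have run_c : run (G j) c 0 =1 fun i => (nu C S j i.+1)%:R.
  have [s run_s] := foldl_run_step_perm (G j) c.
  have dCS'j : [disjoint [set i | e j i \in C'] & [set i | e j i \in S']].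
    apply/pred0P => i; rewrite /= !inE.
    by have /pred0P/(_ (e j i)) := dCS'.
  (* Equivalence of the pairs gives equally many positions of each colour, hence a permutation [t]
     matching [c] with [nu]; composed with [s], it matches the sorted output with [nu]. *)
  have [||t c_nu] := coloring_perm (class_pi C j + 1)%N 1%N (class_pi C j)
    dCS'j (disjoint_nuCS dCS j).
  - by rewrite -(card_setI_class e_enum) (eqP (eqC j)) (card_nuC dCS) setIC.
  - by rewrite -(card_setI_class e_enum) (eqP (eqS j)) (card_nuS dCS) setIC.
  apply: (@nondecreasing_perm_eq _ _ _ _ (s * t)%g) => [i i' le_i|i i' le_i|i].
  - exact: G_sort.
  - by rewrite ler_nat nu_homo.
  rewrite /run run_s !mxE permM nu_coloring // -c_nu !inE /lifted_coef.
  by rewrite (@class_piE _ _ _ j) ?mem_enum_W.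
congr (_ <= _); apply: eq_bigr => i _; last by rewrite run_c.
by rewrite mxE x0 ?mem_enum_W.
Qed.
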